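(* If $\mathcal{C}$ is a complete admissible clutter, then $\mathcal{C}$ is unmixed.
   Context: A clutter $\mathcal{C}$ with finite vertex set $X$ is a family $E(\mathcal{C})$ of subsets of $X$, called edges, none of which is included in another. A vertex cover of $\mathcal{C}$ is a subset of $X$ meeting every edge; it is minimal if no proper subset is a vertex cover. $\mathcal{C}$ is unmixed if all its minimal vertex covers have the same size. Let $X^1,\ldots,X^d$ and $e_1,\ldots,e_g$ be two partitions of a finite set $X$ such that $|e_i\cap X^j|\leq 1$ for all $i,j$. Let $e$ be a subset of $X$ of size $k\geq 1$ such that $|e\cap X^i|\leq 1$ for all $i$. There are unique integers $1\leq i_1<\cdots<i_k\leq d$ and integers $j_1,\ldots,j_k\in\{1,\ldots,g\}$ such that $e\cap X^{i_1}=\{x_1\},\ldots,e\cap X^{i_k}=\{x_k\}$ and $x_1\in e_{j_1},\ldots,x_k\in e_{j_k}$. The set $e$ is called admissible if $i_1=1,i_2=2,\ldots,i_k=k$ and $j_1\leq\cdots\leq j_k$. Suppose $e_1,\ldots,e_g$ are admissible subsets of $X$. The complete admissible clutter (associated with these two partitions) is the clutter $\mathcal{C}$ on $X$ whose set of edges is $$E(\mathcal{C})=\{e\subset X : e_i\not\subset e \mbox{ for } i=1,\ldots,g,\ e \mbox{ is admissible, and } e\not\subset e' \mbox{ for any admissible set } e'\neq e\}\cup\{e_1,\ldots,e_g\}.$$ *)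

(* Defs.v *)
From HB Require Import structures.
From mathcomp Require Import all_boot.

Set Implicit Arguments.
Unset Strict Implicit.
Unset Printing Implicit Defensive.

(* The vertex set X is the whole finite type T. *)

Definition antichain (T : finType) (E : {set {set T}}) : Prop :=
  forall f f' : {set T}, f \in E -> f' \in E -> f \subset f' -> f = f'.

Record clutter (T : finType) := Clutter {
  edges : {set {set T}};
  edges_antichain : antichain edges }.

Definition vertex_cover (T : finType) (C : clutter T) : pred {set T} :=
  fun A => [forall f in edges C, A :&: f != set0].

Definition minimal_vertex_cover (T : finType) (C : clutter T) (A : {set T}) : bool :=
  minset (vertex_cover C) A.

Definition unmixed (T : finType) (C : clutter T) : Prop :=
  forall A B : {set T},
    minimal_vertex_cover C A -> minimal_vertex_cover C B -> #|A| = #|B|.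

(* [F] lists the (nonempty) blocks of a partition without repetition. *)
Definition indexed_partition (T : finType) (n : nat) (F : 'I_n -> {set T}) : Prop :=
  injective F /\ partition [set F i | i : 'I_n] [set: T].

(* i_1 < ... < i_k, f :&: X^{i_t} = {x_t} and x_t \in e_{j_t}, all indices being
   shifted to start from 0. If [P] and [e] are indexed partitions, #|f| = k and
   f meets every block of [P] in at most one point, then such i, j, x exist and
   are unique, so the existential in [admissible_of_size] is about "the" i, j. *)
Definition coordinates (T : finType) (d g : nat)
    (P : 'I_d -> {set T}) (e : 'I_g -> {set T}) (k : nat) (f : {set T})
    (i : {ffun 'I_k -> 'I_d}) (j : {ffun 'I_k -> 'I_g})
    (x : {ffun 'I_k -> T}) : bool :=
  [&& [forall s : 'I_k, forall t : 'I_k, (s < t) ==> (i s < i t)],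
      [forall t : 'I_k, f :&: P (i t) == [set x t]]
    & [forall t : 'I_k, x t \in e (j t)]].

Definition admissible_of_size (T : finType) (d g : nat)
    (P : 'I_d -> {set T}) (e : 'I_g -> {set T}) (k : nat) (f : {set T}) : bool :=
  [&& #|f| == k,
      1 <= k,
      [forall i : 'I_d, #|f :&: P i| <= 1]
    & [exists i : {ffun 'I_k -> 'I_d}, exists j : {ffun 'I_k -> 'I_g},
       exists x : {ffun 'I_k -> T},
       [&& coordinates P e f i j x,
           [forall t : 'I_k, i t == t :> nat]
         & [forall s : 'I_k, forall t : 'I_k, (s <= t) ==> (j s <= j t)]]]].

Definition admissible (T : finType) (d g : nat)
    (P : 'I_d -> {set T}) (e : 'I_g -> {set T}) (f : {set T}) : bool :=
  admissible_of_size P e #|f| f.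

Definition complete_admissible_edges (T : finType) (d g : nat)
    (P : 'I_d -> {set T}) (e : 'I_g -> {set T}) : {set {set T}} :=
  [set f : {set T} |
    [&& [forall i : 'I_g, ~~ (e i \subset f)],
        admissible P e f
      & [forall f' : {set T},
          admissible P e f' ==> (f' != f) ==> ~~ (f \subset f')]]]
  :|: [set e i | i : 'I_g].

Record admissible_partitions (T : finType) (d g : nat)
    (P : 'I_d -> {set T}) (e : 'I_g -> {set T}) : Prop := {
  blocks_partition : indexed_partition P;
  edges_partition : indexed_partition e;
  card_edge_block : forall (i : 'I_g) (j : 'I_d), #|e i :&: P j| <= 1;
  edge_admissible : forall i : 'I_g, admissible P e (e i) }.

Lemma complete_admissible_antichain (T : finType) (d g : nat)
    (P : 'I_d -> {set T}) (e : 'I_g -> {set T}) :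
  admissible_partitions P e -> antichain (complete_admissible_edges P e).
Proof.
case=> _ [_ /and3P[_ /trivIsetP dis_e _]] _ adm f f'.
rewrite !inE => /orP[/and3P[Nf admf maxf]|/imsetP[i _ ->]].
  move=> f'E ff'; have admf' : admissible P e f'.
    by case/orP: f'E => [/and3P[]|/imsetP[i _ ->]].
  apply/eqP; apply: contraLR ff' => nff'.
  move/forallP/(_ f')/implyP/(_ admf')/implyP: maxf; apply.
  by rewrite eq_sym.
case/orP=> [/and3P[/forallP/(_ i)/negP Nf' _ _] /Nf' //|/imsetP[j _ ->] eij].
apply/eqP; case: eqVneq => // neij.
have /dis_e := imset_f e (isT : i \in 'I_g).
move=> /(_ _ (imset_f e (isT : j \in 'I_g)) neij) /disjoint_setI0.
have /and4P[_ ei0 _ _] := adm i; move: ei0; rewrite card_gt0 => /set0Pn[z zi].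
by move=> /setP/(_ z); rewrite !inE zi (subsetP eij _ zi).
Qed.

Definition complete_admissible_clutter (T : finType) (C : clutter T) : Prop :=
  exists (d g : nat) (P : 'I_d -> {set T}) (e : 'I_g -> {set T}),
    admissible_partitions P e /\ edges C = complete_admissible_edges P e.

(* Main.v *)
Require Import Defs.
From HB Require Import structures.
From mathcomp Require Import all_boot.

(** Place each vertex in the grid whose rows are the blocks [X^j] and whose
    columns are the edges [e_i]; a vertex is determined by its cell. Admissible
    sets are then the nonempty sets that occupy an initial segment of the rows
    and whose columns weakly increase with the row (lemma [admissibleP]); two
    vertices in one row would then share their column, hence coincide.

    Every vertex cover meets each of the [g] columns, since these are edges, so
    it suffices to show that a minimal vertex cover [A] contains at most one
    vertex of each column ([minimal_cover_col_inj]); then [#|A| = g].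
    Suppose that [A] contains [x] and [y] in one column, [x] in row [s] and [y]
    strictly above. By minimality there are edges [f] and [f'] that meet [A] only
    in [x] and only in [y]. Neither is a column, so both are maximal admissible
    sets. Follow [f'] up to row [s] and [f] from there on: since [f'] passes
    later through [y], and [f] passes through [x] in row [s], the result [h] is
    still weakly increasing, and it avoids both [x] and [y], so it misses [A].
    The set [h] is again maximal ([splice_maximal]): maximality of an admissible
    set depends only on where it ends, and [f] does go on above row [s],
    because it could otherwise be prolonged by the part of the common column
    above [x]. Hence either [h] is an edge or it contains a column, which is an
    edge; in both cases [A] misses an edge, a contradiction. *)

Set Implicit Arguments.
Unset Strict Implicit.
Unset Printing Implicit Defensive.

(** * Minimal vertex covers *)

(** Otherwise [A :\ x] would be a smaller cover. *)
Lemma minimal_cover_private_edge (T : finType) (C : clutter T) (A : {set T}) x :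
  minimal_vertex_cover C A -> x \in A ->
  exists2 f, f \in edges C & A :&: f = [set x].
Proof.
case/minsetP=> /forall_inP coverA minA xA.
have: ~~ vertex_cover C (A :\ x).
  apply: contraTN xA => coverAx.
  by rewrite -(minA _ coverAx (subD1set A x)) setD11.
case/forall_inPn=> f fE; rewrite negbK => /eqP Axf0; exists f => //.
have sub: A :&: f \subset [set x].
  apply/subsetP=> z /setIP[zA zf]; rewrite inE; apply: contraTT isT => zx.
  by have /setP/(_ z) := Axf0; rewrite !inE zx zA zf.
by apply/eqP; rewrite -subset_leqif_cards // cards1 eqn_leq -{1}(cards1 x)
  subset_leq_card //= card_gt0 coverA.
Qed.

(** * Grid coordinates and admissible sets *)

Definition labelling (T : finType) n (F : 'I_n -> {set T}) (l : T -> 'I_n) :=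
  forall x i, (x \in F i) = (l x == i).

Lemma partition_labelling (T : finType) n (F : 'I_n -> {set T}) :
  Defs.indexed_partition F -> exists l, labelling F l.
Proof.
case=> injF /and3P[/eqP covF /trivIsetP disF _].
have /fin_all_exists[l lP] (x : T) : exists i, x \in F i.
  have: x \in cover [set F i | i : 'I_n] by rewrite covF inE.
  by case/bigcupP=> _ /imsetP[i _ ->] xi; exists i.
exists l => x i; apply/idP/eqP=> [xi | <- //].
apply: contraTeq xi => neq; have neqF: F (l x) != F i.
  by apply: contraNneq neq => /injF ->.
by rewrite (disjointFr (disF _ _ _ _ neqF)) ?imset_f.
Qed.

(** Admissibility in grid coordinates, see [admissibleP]. It mentions neither the
    size of [f] nor an enumeration of it, so it can be checked vertex by vertex
    on a set assembled from two others. *)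
Record staircase (T : finType) d g (row : T -> 'I_d) (col : T -> 'I_g)
    (f : {set T}) : Prop := Staircase {
  staircase_neq0 : f != set0;
  staircase_mono : {in f &, forall x y, row x <= row y -> col x <= col y};
  staircase_down : {in f, forall y (r : nat), r < row y ->
                      exists2 x, x \in f & row x = r :> nat} }.

Definition max_staircase (T : finType) d g (row : T -> 'I_d) (col : T -> 'I_g)
    (f : {set T}) :=
  staircase row col f /\
  forall f', staircase row col f' -> f \subset f' -> f' = f.

Definition splice (T : finType) d (row : T -> 'I_d) s (a b : {set T}) :=
  [set z in a | row z <= s] :|: [set z in b | s < row z].

Section Grid.

Variables (T : finType) (d g : nat) (P : 'I_d -> {set T}) (e : 'I_g -> {set T}).
Variables (row : T -> 'I_d) (col : T -> 'I_g).
Hypothesis rowP : labelling P row.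
Hypothesis colP : labelling e col.
Hypothesis cell_inj : forall x y, row x = row y -> col x = col y -> x = y.

Lemma staircase_row_inj f : staircase row col f -> {in f &, injective row}.
Proof.
case=> _ mono _ x y xf yf exy; apply: cell_inj (exy) _; apply/val_inj/eqP.
by rewrite eqn_leq !mono ?exy.
Qed.

(** If row [t] were empty, then by downward closure all of [f] would lie in the
    [t] rows below it, with at most one vertex in each, so [#|f| <= t]. *)
Lemma staircase_fills_rows (f : {set T}) (t : 'I_#|f|) :
  staircase row col f -> exists2 x, x \in f & row x = t :> nat.
Proof.
move=> stf; have [_ _ down] := stf.
case: (pickP [pred x in f | row x == t :> nat]) => [x /andP[xf /eqP] | none].
  by exists x.
have row_lt x : x \in f -> row x < t.
  move=> xf; rewrite ltnNge leq_eqVlt; apply/norP; split.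
    by have := none x; rewrite /= xf /= eq_sym => ->.
  apply/negP => /(down x xf)[z zf ez].
  by have := none z; rewrite /= zf ez eqxx.
suff: size [seq val (row x) | x in f] <= size (iota 0 t).
  by rewrite size_map -cardE size_iota leqNgt ltn_ord.
apply: uniq_leq_size => [|_ /mapP[x + ->]]; last first.
  by rewrite mem_enum mem_iota => /row_lt.
rewrite map_inj_in_uniq ?enum_uniq // => x z.
by rewrite !mem_enum => xf zf /val_inj; apply: staircase_row_inj stf _ _ xf zf.
Qed.

(** The vertex [x t] of the coordinates is the one in row [t]. *)
Lemma admissibleP f : reflect (staircase row col f) (admissible P e f).
Proof.
apply: (iffP and4P) => [[_ f_gt0 _]|stf].
  case/existsP=> i /existsP[j /existsP[x]].
  case/and3P=> /and3P[_ /forallP fPi /forallP xej] /forallP ival.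
  move/forallP=> jmono.
  have xfP t : x t \in f /\ row (x t) = t :> nat.
    have /eqP/setP/(_ (x t)) := fPi t.
    by rewrite !inE eqxx rowP => /andP[-> /eqP->]; split=> //; apply/eqP.
  have colx t : col (x t) = j t by apply/eqP; rewrite -colP.
  have fE: f = [set x t | t : 'I_#|f|].
    apply/esym/eqP; rewrite eqEcard card_in_imset ?card_ord ?leqnn ?andbT.
      by apply/subsetP=> _ /imsetP[t _ ->]; case: (xfP t).
    move=> t u _ _ ext; apply: ord_inj.
    by rewrite -(xfP t).2 -(xfP u).2 ext.
  have fx z : z \in f -> exists t, z = x t.
    by rewrite {1}fE => /imsetP[t _ ->]; exists t.
  split; first by rewrite -card_gt0.
    move=> _ _ /fx[t ->] /fx[u ->]; rewrite !(xfP _).2 !colx.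
    by have /forallP/(_ u)/implyP := jmono t.
  move=> _ /fx[u ->] r; rewrite (xfP u).2 => r_lt_u.
  have r_lt := ltn_trans r_lt_u (ltn_ord u).
  by exists (x (Ordinal r_lt)); case: (xfP (Ordinal r_lt)).
have row_inj := staircase_row_inj stf.
have [f0 mono down] := stf.
have /fin_all_exists2[x xf rowx] t := staircase_fills_rows t stf.
split=> //; first by rewrite card_gt0.
  apply/forallP=> i; apply/card_le1_eqP=> y z; rewrite !inE !rowP.
  by case/andP=> yf /eqP yi /andP[zf /eqP zi]; apply: row_inj; rewrite ?yi.
apply/existsP; exists [ffun t => row (x t)].
apply/existsP; exists [ffun t => col (x t)].
apply/existsP; exists [ffun t => x t].
apply/and3P; split; first (apply/and3P; split).
- apply/forallP=> t; apply/forallP=> u; apply/implyP.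
  by rewrite !ffunE !rowx.
- apply/forallP=> t; rewrite !ffunE; apply/eqP/setP=> z; rewrite !inE rowP.
  apply/andP/eqP=> [[zf /eqP ezt]|->]; first exact: row_inj.
  by rewrite xf eqxx.
- by apply/forallP=> t; rewrite !ffunE colP.
- by apply/forallP=> t; rewrite ffunE rowx.
- apply/forallP=> t; apply/forallP=> u; apply/implyP; rewrite !ffunE => tu.
  by rewrite mono ?rowx.
Qed.

(** * Splicing staircases *)

(** The column [c] separates the two parts; a vertex of [a] in row [s] is there
    so that no row is skipped at the junction. *)
Lemma splice_staircase a b s (c : 'I_g) :
    staircase row col a -> staircase row col b ->
    (exists2 x, x \in a & row x = s :> nat) ->
    {in a, forall z, row z <= s -> col z <= c} ->
    {in b, forall w, s < row w -> c <= col w} ->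
  staircase row col (splice row s a b).
Proof.
case=> _ monoa downa [_ monob downb] [x xa rx] a_le_c c_le_b; split.
- by apply/set0Pn; exists x; rewrite !inE xa rx leqnn.
- move=> z w; rewrite !inE.
  case/orP=> /andP[zf zs] /orP[]/andP[wf ws]; [exact: monoa| | |exact: monob].
    by move=> _; apply: leq_trans (a_le_c z zf zs) (c_le_b w wf ws).
  by move/(leq_trans zs)/leq_trans/(_ ws); rewrite ltnn.
move=> w w_in r r_lt; have [r_le|s_lt] := leqP r s.
  have [z za rz] : exists2 z, z \in a & row z = r :> nat.
    move: r_le; rewrite leq_eqVlt -rx => /predU1P[->|]; first by exists x.
    exact: downa.
  by exists z; rewrite // !inE za rz r_le.
have wb: w \in b.
  move: w_in; rewrite !inE => /orP[]/andP[// _ /(leq_trans r_lt)/ltnW].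
  by rewrite leqNgt s_lt.
have [z zb rz] := downb w wb r r_lt.
by exists z; rewrite // !inE zb rz s_lt orbT.
Qed.

(** If [f] stopped in row [row x], then the part of the column above [x] would
    prolong it. *)
Lemma max_staircase_continues f x y :
    (forall i, staircase row col (e i)) -> max_staircase row col f ->
    x \in f -> col y = col x -> row x < row y ->
  exists2 w, w \in f & row w = (row x).+1 :> nat.
Proof.
move=> ste [stf maxf] xf cyx rxy; have [_ monof downf] := stf.
have [w /andP[wf]|none] := pickP [pred w in f | row x < row w].
  by rewrite leq_eqVlt => /predU1P[->|/(downf w wf)//]; exists w.
have stq : staircase row col (splice row (row x) f (e (col x))).
  apply: (@splice_staircase _ _ _ (col x)) => //; first by exists x.
    by move=> z zf; apply: monof.
  by move=> w; rewrite colP => /eqP->.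
have /setP/(_ y) : splice row (row x) f (e (col x)) = f.
  apply: maxf stq _; apply/subsetP=> z zf; rewrite !inE zf /= leqNgt.
  by have := none z; rewrite /= zf /= => ->.
rewrite !inE colP cyx eqxx rxy orbT => /esym yf.
by have := none y; rewrite /= yf rxy.
Qed.

(** Maximality of a staircase depends only on its end. A staircase [h]
    containing the splice agrees with it up to row [row x], because [f'] already
    fills these rows; splicing [f] below [h] gives a staircase containing [f],
    so they also agree above. *)
Lemma splice_maximal f f' x y :
    (forall i, staircase row col (e i)) ->
    max_staircase row col f -> staircase row col f' ->
    x \in f -> y \in f' -> col y = col x -> row x < row y ->
  max_staircase row col (splice row (row x) f' f).
Proof.
move=> ste maxsf stf' xf yf' cyx rxy.
have [w wf rw] := max_staircase_continues ste maxsf xf cyx rxy.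
have [stf maxf] := maxsf; have [_ monof downf] := stf.
have [_ monof' downf'] := stf'; split.
  apply: (@splice_staircase _ _ _ (col x)) => //; first exact: downf' yf' _ rxy.
    by move=> z zf' zx; rewrite -cyx monof' // (leq_trans zx) // ltnW.
  by move=> z zf /ltnW; apply: monof.
move=> h sth /subsetP sub; have [_ monoh _] := sth.
have wh: w \in h by rewrite sub // !inE wf rw leqnn orbT.
have fE: splice row (row x) f h = f.
  apply: maxf; last first.
    apply/subsetP=> z zf; rewrite !inE zf /=; have [//|xz] := leqP.
    by rewrite sub // !inE zf xz orbT.
  apply: (@splice_staircase _ _ _ (col x)) => //; first by exists x.
    by move=> z zf; apply: monof.
  move=> z zh xz; apply: leq_trans (monoh w z wh zh _); last by rewrite rw.
  by rewrite monof // rw.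
apply/eqP; rewrite eqEsubset andbC; apply/andP; split; first exact/subsetP.
apply/subsetP=> z zh; rewrite !inE; have [zx|xz] := leqP (row z) (row x).
  have [u uf' ru] := downf' y yf' _ (leq_ltn_trans zx rxy).
  suff <- : u = z by rewrite uf'.
  apply: (staircase_row_inj sth) => //; last exact: val_inj.
  by rewrite sub // !inE uf' ru zx.
by rewrite -fE !inE xz zh orbT orbT.
Qed.

(** * Minimal covers of the complete admissible clutter *)

Variable C : clutter T.
Hypothesis ste : forall i, staircase row col (e i).
Hypothesis edgesC : edges C = complete_admissible_edges P e.

Lemma column_edge i : e i \in edges C.
Proof. by rewrite edgesC inE imset_f ?orbT. Qed.

Lemma max_staircase_edge f :
  max_staircase row col f -> (forall i, ~~ (e i \subset f)) -> f \in edges C.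
Proof.
case=> stf maxf nef; rewrite edgesC !inE; apply/orP; left; apply/and3P; split.
- exact/forallP.
- exact/admissibleP.
apply/forallP=> f'; apply/implyP=> /admissibleP stf'; apply/implyP.
by apply: contraNN => /(maxf _ stf')->.
Qed.

Lemma edge_max_staircase f :
  f \in edges C -> (forall i, f <> e i) -> max_staircase row col f.
Proof.
rewrite edgesC !inE => /orP[|/imsetP[i _ fe] /(_ i)//].
case/and3P=> _ /admissibleP stf /forallP maxf _; split=> // f' stf' ff'.
apply/eqP; apply: contraTT ff'; apply/implyP.
exact/(implyP (maxf f'))/admissibleP.
Qed.

Lemma cover_meets A f :
  vertex_cover C A -> f \in edges C -> exists2 z, z \in A & z \in f.
Proof.
move/forall_inP=> coverA /coverA/set0Pn[z /setIP[]].
by exists z.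
Qed.

(** If [y] lay above [x], splicing the private edges of [y] and [x] in row
    [row x] would yield a maximal staircase missing [A]. *)
Lemma minimal_cover_row_le A x y :
    minimal_vertex_cover C A -> x \in A -> y \in A -> col y = col x ->
  row y <= row x.
Proof.
move=> minA xA yA cyx; rewrite leqNgt; apply/negP=> rxy.
have coverA: vertex_cover C A by case/minsetP: minA.
have [f fE Af] := minimal_cover_private_edge minA xA.
have [f' f'E Af'] := minimal_cover_private_edge minA yA.
have neq_xy: x != y by apply: contraTneq rxy => ->; rewrite ltnn.
have /setIP[_ xf] : x \in A :&: f by rewrite Af inE.
have /setIP[_ yf'] : y \in A :&: f' by rewrite Af' inE.
have f_x z : z \in A -> z \in f -> z = x.
  by move=> zA zf; apply/set1P; rewrite -Af inE zA.
have f'_y z : z \in A -> z \in f' -> z = y.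
  by move=> zA zf'; apply/set1P; rewrite -Af' inE zA.
(* A column containing x or y is the common one, which meets A in both. *)
have maxf: max_staircase row col f.
  apply: edge_max_staircase fE _ => i fe; case/eqP: neq_xy.
  apply/esym/(f_x y yA); move: xf; rewrite fe !colP => /eqP<-.
  by rewrite cyx.
have [stf' _] : max_staircase row col f'.
  apply: edge_max_staircase f'E _ => i fe; case/eqP: neq_xy.
  apply/(f'_y x xA); move: yf'; rewrite fe !colP => /eqP<-.
  by rewrite cyx.
have missA z : z \in A -> z \notin splice row (row x) f' f.
  move=> zA; rewrite !inE negb_or; apply/andP; split; apply/negP=> /andP[zf].
    by rewrite (f'_y z) // leqNgt rxy.
  by rewrite (f_x z) // ltnn.
have maxh := splice_maximal ste maxf stf' xf yf' cyx rxy.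
have [z zA] : exists2 z, z \in A & z \in splice row (row x) f' f.
  have [i /subsetP eh|none] :=
    pickP [pred i | e i \subset splice row (row x) f' f].
    have [z zA /eh zh] := cover_meets coverA (column_edge i).
    by exists z.
  apply: cover_meets coverA (max_staircase_edge maxh _) => i.
  exact: negbT (none i).
by rewrite (negbTE (missA z zA)).
Qed.

Lemma minimal_cover_col_inj A :
  minimal_vertex_cover C A -> {in A &, injective col}.
Proof.
move=> minA x y xA yA cxy; apply: cell_inj (cxy); apply/val_inj/eqP.
by rewrite eqn_leq !(minimal_cover_row_le minA).
Qed.

Lemma card_minimal_cover A : minimal_vertex_cover C A -> #|A| = g.
Proof.
move=> minA; rewrite -(card_in_imset (minimal_cover_col_inj minA)).
have /minsetp coverA := minA; rewrite -[RHS]card_ord -cardsT.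
congr #|pred_of_set _|; apply/setP=> i; rewrite inE.
have [z zA] := cover_meets coverA (column_edge i).
by rewrite colP => /eqP<-; rewrite imset_f.
Qed.

End Grid.

Theorem proposition3p6 (T : finType) (C : clutter T) :
  complete_admissible_clutter C -> unmixed C.
Proof.
case=> d [g [P [e [[partP parte card_eP adm_e] edgesC]]]] A B minA minB.
have [row rowP] := partition_labelling partP.
have [col colP] := partition_labelling parte.
have cell_inj x y : row x = row y -> col x = col y -> x = y.
  move=> rxy cxy; apply: (card_le1_eqP (card_eP (col x) (row x))).
    by rewrite in_setI rowP colP rxy cxy !eqxx.
  by rewrite in_setI rowP colP !eqxx.
have ste i : staircase row col (e i) by apply/(admissibleP rowP colP cell_inj).
have card_g := card_minimal_cover rowP colP cell_inj ste edgesC.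
by rewrite !card_g.
Qed.
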